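(* Let $X$ be a good topological space, let $p:\widetilde{X}\to X$ be its universal cover and let $G=\mathrm{Deck}(\widetilde{X}/X)$ be the group of deck transformations. Then $AC(X)=TC_G(\widetilde{X})$.
   Context: A space is good if it is path connected and admits a universal cover; equivalently, it is path connected, locally path connected and semilocally simply connected. An open subset $U\subseteq X$ is nice if it is path connected and the inclusion induces the trivial map $\pi_1(U,x)\to\pi_1(X,x)$ for every $x\in U$; in a good space the nice open sets form a basis of the topology. Let $I=[0,1]$ and let $X^I$ be the space of all continuous paths $I\to X$ with the compact-open topology. $\Pi(X)$ is the set of homotopy classes relative to endpoints $[\gamma]$ of paths $\gamma:I\to X$, with the topology having as basis the sets $S(U,V,[\gamma])=\{[\delta_1*\gamma*\delta_2]\}$, where $U,V\subseteq X$ are nice open sets, $\gamma$ is a path with $\gamma(0)\in U$ and $\gamma(1)\in V$, and $\delta_1$ (resp. $\delta_2$) ranges over the paths contained in $U$ ending at $\gamma(0)$ (resp. contained in $V$ starting at $\gamma(1)$); $*$ is concatenation. Let $q:X^I\to\Pi(X)$ be the quotient map $q(\gamma)=[\gamma]$. The (normalized) asphericity complexity $AC(X)$ is the minimum integer $k\ge 0$ such that $\Pi(X)$ can be covered by open subsets $U_0,\dots,U_k$, each admitting a continuous map $s_j:U_j\to X^I$ with $q\circ s_j$ equal to the inclusion $U_j\hookrightarrow\Pi(X)$ ($AC(X)=\infty$ if there is no such $k$). For a $G$-space $Z$, $G$ acts on $Z^I$ by $(h\gamma)(t)=h\cdot\gamma(t)$ and diagonally on $Z\times Z$. The (normalized)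 equivariant topological complexity $TC_G(Z)$ is the minimum integer $k\ge 0$ such that $Z\times Z$ can be covered by $G$-invariant open subsets $U_0,\dots,U_k$, each admitting a $G$-equivariant continuous map $s_j:U_j\to Z^I$ such that $\pi\circ s_j$ is the inclusion $U_j\hookrightarrow Z\times Z$, where $\pi:Z^I\to Z\times Z$ is $\pi(\gamma)=(\gamma(0),\gamma(1))$ ($TC_G(Z)=\infty$ if there is no such $k$). *)

(* Defs.v *)
From HB Require Import structures.
From mathcomp Require Import all_boot all_order all_algebra generic_quotient.
From mathcomp Require Import all_classical all_reals all_analysis.

Set Implicit Arguments.
Unset Strict Implicit.
Unset Printing Implicit Defensive.

Import Order.TTheory GRing.Theory Num.Theory.
Import numFieldNormedType.Exports.

Local Open Scope classical_set_scope.
Local Open Scope ring_scope.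
Local Open Scope quotient_scope.

Definition unit_interval (R : realType) : Type :=
  set_type [set` `[0%R : R, 1%R]].

HB.instance Definition _ (R : realType) :=
  Topological.copy (unit_interval R) (set_type [set` `[0%R : R, 1%R]]).

Section UnitInterval.
Context {R : realType}.
Local Notation I := (unit_interval R).

Definition ival (t : I) : R := set_val t.

Lemma ival_ge0 (t : I) : 0 <= ival t.
Proof. by have := set_mem (valP t); rewrite /= in_itv /= => /andP[]. Qed.

Lemma ival_le1 (t : I) : ival t <= 1.
Proof. by have := set_mem (valP t); rewrite /= in_itv /= => /andP[]. Qed.

Lemma ival_inj : injective ival.
Proof. exact: val_inj. Qed.

Lemma ival_continuous : continuous ival.
Proof. exact: initial_continuous. Qed.

Lemma clamp_subproof (r : R) :
  Num.max 0 (Num.min r 1) \in [set` `[0%R : R, 1%R]].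
Proof.
by rewrite inE /= in_itv /= le_max lexx /= ge_max ler01 ge_min lexx orbT.
Qed.

(* Nearest-point projection of the real line onto [0, 1]; it serves to name
   the points of I. *)
Definition clamp (r : R) : I := SigSub (clamp_subproof r).

Lemma clampE (r : R) : ival (clamp r) = Num.max 0 (Num.min r 1).
Proof. by []. Qed.

Lemma clampK (r : R) : 0 <= r -> r <= 1 -> ival (clamp r) = r.
Proof. by move=> r0 r1; rewrite clampE (min_idPl r1) (max_idPr r0). Qed.

Lemma ivalK : cancel ival clamp.
Proof. by move=> t; apply: ival_inj; rewrite clampK ?ival_ge0 ?ival_le1. Qed.

Lemma piecewise_continuous (T X : topologicalType) (c : T -> R) (a : R)
    (f g : T -> X) :
  continuous c -> continuous f -> continuous g ->
  (forall x, c x = a -> f x = g x) ->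
  continuous (fun x => if c x <= a then f x else g x).
Proof.
move=> cc cf cg fg; apply/continuous_subspace_setT.
have -> : [set: T] = (c @^-1` [set r | r <= a]) `|` (c @^-1` [set r | a <= r]).
  by rewrite eqEsubset; split=> // x _ /=; apply/orP; exact: le_total.
apply: withinU_continuous.
- by apply: preimage_closed => //; exact: closed_le.
- by apply: preimage_closed => //; exact: closed_ge.
- apply: (@subspace_eq_continuous _ _ _ f); last exact: continuous_subspaceT.
  by move=> x /set_mem /= xa; rewrite /from_subspace xa.
- apply: (@subspace_eq_continuous _ _ _ g); last exact: continuous_subspaceT.
  move=> x /set_mem /= ax; rewrite /from_subspace; case: ifP => // xa.
  by rewrite fg //; apply/eqP; rewrite eq_le xa ax.
Qed.

Lemma pair_continuous (T X Y : topologicalType) (f : T -> X) (g : T -> Y) :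
  continuous f -> continuous g -> continuous (fun x => (f x, g x)).
Proof. by move=> fc gc x; apply: cvg_pair; [exact: fc|exact: gc]. Qed.

Lemma clamp_continuous : continuous clamp.
Proof.
have hc : continuous (ival \o clamp).
  have -> : ival \o clamp =
      fun r => if (if r <= 1 then r else 1) <= 0 then 0
               else if r <= 1 then r else 1.
    by apply/funext => r /=; rewrite clampE maxC maxEle minEle.
  have c1 : continuous (fun r : R => if r <= 1 then r else 1).
    by apply: (@piecewise_continuous R R id 1 id (cst 1)) => // x;
      [exact: cvg_id|exact: cvg_id|exact: cvg_cst].
  apply: (@piecewise_continuous R R (fun r : R => if r <= 1 then r else 1) 0
    (cst 0) (fun r : R => if r <= 1 then r else 1)) => // x; exact: cvg_cst.
exact: (@continuous_comp_initial I R R ival clamp hc).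
Qed.

Lemma clamp_affine_continuous (T : topologicalType) (c : T -> R) (u v : R) :
  continuous c -> continuous (fun x => clamp (u * c x + v)).
Proof.
move=> cc x.
apply: (@continuous_comp _ _ _ (fun x => u * c x + v) clamp); last first.
  exact: clamp_continuous.
by apply: cvgD; [apply: cvgM; [exact: cvg_cst|exact: cc]|exact: cvg_cst].
Qed.

Lemma clamp_scale_continuous (T : topologicalType) (c : T -> R) (u : R) :
  continuous c -> continuous (fun x => clamp (u * c x)).
Proof.
move=> cc; under eq_fun do rewrite -[u * _]addr0.
exact: clamp_affine_continuous.
Qed.

Definition I0 : I := clamp 0.
Definition I1 : I := clamp 1.

Lemma ival0 : ival I0 = 0. Proof. by rewrite clampK. Qed.
Lemma ival1 : ival I1 = 1. Proof. by rewrite clampK. Qed.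

End UnitInterval.

Definition path_space (R : realType) (X : topologicalType) : Type :=
  continuousType (unit_interval R) X.

Section PathSpace.
Context (R : realType) (X : topologicalType).
HB.instance Definition _ := Choice.on (path_space R X).
HB.instance Definition _ := Topological.copy (path_space R X)
  (@initial_topology (path_space R X) {compact-open, unit_interval R -> X}
     (fun (g : path_space R X) => (g : unit_interval R -> X))).
End PathSpace.

Section Paths.
Context {R : realType} {X : topologicalType}.
Local Notation I := (unit_interval R).
Local Notation path := (path_space R X).
Implicit Types (f g h : path) (x : X).

Definition mkpath (f : I -> X) (fc : continuous f) : path := mkcts fc.

Definition const_path x : path := cst x : continuousType I X.

Definition concat_fun f g (t : I) : X :=
  if ival t <= 2^-1 then f (clamp (2 * ival t)) else g (clamp (2 * ival t - 1)).

Lemma concat_continuous f g : f I1 = g I0 -> continuous (concat_fun f g).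
Proof.
move=> fg; apply: piecewise_continuous.
- exact: ival_continuous.
- move=> t; apply: (@continuous_comp _ _ _ (fun t => clamp (2 * ival t)) f).
    by apply: clamp_scale_continuous; exact: ival_continuous.
  exact: cts_fun.
- move=> t.
  apply: (@continuous_comp _ _ _ (fun t => clamp (2 * ival t - 1)) g).
    by apply: clamp_affine_continuous; exact: ival_continuous.
  exact: cts_fun.
- by move=> t ->; rewrite mulfV ?pnatr_eq0// subrr.
Qed.

Definition concat f g (fg : f I1 = g I0) : path :=
  mkpath (concat_continuous fg).

Lemma concat_1 f g (fg : f I1 = g I0) : concat fg I1 = g I1.
Proof.
rewrite -[LHS]/(concat_fun f g I1) /concat_fun ival1 ifF.
  by congr (g _); congr clamp; rewrite mulr1 -{1}[2]/(1 + 1) addrK.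
by apply/negbTE; rewrite -ltNge invf_lt1 ?ltr1n.
Qed.

Definition is_homotopy f g (H : I * I -> X) : Prop :=
  [/\ continuous H,
      forall t, H (t, I0) = f t,
      forall t, H (t, I1) = g t,
      forall s, H (I0, s) = f I0 &
      forall s, H (I1, s) = f I1].

Definition homotopic f g : Prop := exists H, is_homotopy f g H.

Lemma homotopic_refl f : homotopic f f.
Proof.
exists (fun z => f z.1); split=> // z.
by apply: (@continuous_comp _ _ _ fst f); [exact: cvg_fst|exact: cts_fun].
Qed.

Lemma homotopic_ends f g : homotopic f g -> f I0 = g I0 /\ f I1 = g I1.
Proof. by move=> [H [_ _ H1 Hl Hr]]; rewrite -!H1 Hl Hr. Qed.

Lemma homotopic_sym f g : homotopic f g -> homotopic g f.
Proof.
move=> fg; have [e0 e1] := homotopic_ends fg; move: fg => [H [Hc H0 H1 Hl Hr]].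
have sc : continuous (fun z : I * I => ival z.2).
  move=> z; apply: (@continuous_comp _ _ _ snd ival); first exact: cvg_snd.
  exact: ival_continuous.
exists (fun z => H (z.1, clamp (- 1 * ival z.2 + 1))); split.
- move=> z; apply: (@continuous_comp _ _ _
    (fun z : I * I => (z.1, clamp (- 1 * ival z.2 + 1))) H); last exact: Hc.
  apply: (@pair_continuous (I * I)%type I I fst).
      by move=> ?; exact: cvg_fst.
  exact: clamp_affine_continuous.
- by move=> t /=; rewrite ival0 mulr0 add0r H1.
- by move=> t /=; rewrite ival1 mulr1 addNr H0.
- by move=> s /=; rewrite Hl.
- by move=> s /=; rewrite Hr.
Qed.

Lemma homotopic_trans f g h : homotopic f g -> homotopic g h -> homotopic f h.
Proof.
move=> fg; have [e0 e1] := homotopic_ends fg.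
move: fg => [H [Hc H0 H1 Hl Hr]] [K [Kc K0 K1 Kl Kr]].
have sc : continuous (fun z : I * I => ival z.2).
  move=> z; apply: (@continuous_comp _ _ _ snd ival); first exact: cvg_snd.
  exact: ival_continuous.
exists (fun z => if ival z.2 <= 2^-1 then H (z.1, clamp (2 * ival z.2))
                 else K (z.1, clamp (2 * ival z.2 - 1))); split.
- apply: piecewise_continuous => //.
  + move=> z; apply: (@continuous_comp _ _ _
      (fun z : I * I => (z.1, clamp (2 * ival z.2))) H); last exact: Hc.
    apply: (@pair_continuous (I * I)%type I I fst).
      by move=> ?; exact: cvg_fst.
    exact: clamp_scale_continuous.
  + move=> z; apply: (@continuous_comp _ _ _
      (fun z : I * I => (z.1, clamp (2 * ival z.2 - 1))) K); last exact: Kc.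
    apply: (@pair_continuous (I * I)%type I I fst).
      by move=> ?; exact: cvg_fst.
    exact: clamp_affine_continuous.
  + by move=> z ->; rewrite mulfV ?pnatr_eq0// subrr H1 K0.
- by move=> t /=; rewrite ival0 invr_ge0 ler0n mulr0 H0.
- move=> t /=; rewrite ival1 ifF; last first.
    by apply/negbTE; rewrite -ltNge invf_lt1 ?ltr1n.
  by rewrite mulr1 -{1}[2]/(1 + 1) addrK K1.
- by move=> s /=; rewrite Hl Kl e0 if_same.
- by move=> s /=; rewrite Hr Kr e1 if_same.
Qed.

Lemma homotopic_equiv : equiv_class_of (fun f g : path => `[< homotopic f g >]).
Proof.
split.
- by move=> f; apply/asboolP; exact: homotopic_refl.
- by move=> f g; apply/asboolP/asboolP; exact: homotopic_sym.
- move=> g f h /asboolP fg /asboolP gh; apply/asboolP.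
  exact: homotopic_trans fg gh.
Qed.

Canonical homotopic_rel : equiv_rel path := EquivRelPack homotopic_equiv.

Definition path_connected_set (A : set X) : Prop := forall x y, A x -> A y ->
  exists f : path, [/\ f I0 = x, f I1 = y & range f `<=` A].

(* Each loop in A is null-homotopic in X: the homomorphisms
   pi_1(A, x) -> pi_1(X, x), for x in A, are trivial. *)
Definition pi1_trivial_in (A : set X) : Prop := forall x, A x ->
  forall f : path, f I0 = x -> f I1 = x -> range f `<=` A ->
  homotopic f (const_path x).

Definition nice (U : set X) : Prop :=
  [/\ open U, path_connected_set U & pi1_trivial_in U].

End Paths.

Definition locally_path_connected (R : realType) (X : topologicalType) : Prop :=
  forall (x : X) (W : set X), nbhs x W ->
  exists U : set X, [/\ open_nbhs x U, @path_connected_set R X U & U `<=` W].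

(* Together with path connectedness and local path connectedness, this is the
   usual criterion for the existence of a universal cover. *)
Definition semilocally_simply_connected (R : realType) (X : topologicalType) :
    Prop :=
  forall x : X, exists2 U : set X, open_nbhs x U &
    forall f : path_space R X, f I0 = x -> f I1 = x -> range f `<=` U ->
    homotopic f (const_path x).

Definition simply_connected (R : realType) (X : topologicalType) : Prop :=
  @path_connected_set R X setT /\ @pi1_trivial_in R X setT.

Definition good (R : realType) (X : topologicalType) : Prop :=
  [/\ @path_connected_set R X setT, locally_path_connected R X &
      semilocally_simply_connected R X].

Definition homeomorphism_on (S T : topologicalType) (f : S -> T)
    (A : set S) (B : set T) : Prop :=
  [/\ {within A, continuous f}, set_bij A B f &
      exists g : set_type B -> set_type A,
        continuous g /\ forall b, f (set_val (g b)) = set_val b].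

Definition evenly_covered (E X : topologicalType) (p : E -> X) (U : set X) :
    Prop :=
  exists (J : Type) (V : J -> set E),
    [/\ forall j, open (V j),
        trivIset setT V,
        p @^-1` U = \bigcup_j V j &
        forall j, homeomorphism_on p (V j) U].

Definition covering_map (E X : topologicalType) (p : E -> X) : Prop :=
  [/\ continuous p, set_surj setT setT p &
      forall x : X, exists2 U : set X, open_nbhs x U & evenly_covered p U].

Definition universal_cover (R : realType) (E X : topologicalType) (p : E -> X) :
    Prop :=
  covering_map p /\ simply_connected R E.

Record deck (E X : topologicalType) (p : E -> X) : Type := Deck {
  deck_fun :> E -> E;
  deck_inv_fun : E -> E;
  deck_continuous : continuous deck_fun;
  deck_inv_continuous : continuous deck_inv_fun;
  deckK : cancel deck_fun deck_inv_fun;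
  deckVK : cancel deck_inv_fun deck_fun;
  deck_over : p \o deck_fun = p
}.

Section DeckGroup.
Context (E X : topologicalType) (p : E -> X).
Implicit Types g h : deck p.

HB.instance Definition _ := gen_eqMixin (deck p).
HB.instance Definition _ := gen_choiceMixin (deck p).

Lemma deck_ext g h : (g : E -> E) = h -> g = h.
Proof.
case: g h => [f f' fc f'c fK f'K fp] [g g' gc g'c gK g'K gp] /= e.
move: e gc gK g'K gp => <- gc gK g'K gp.
have e : f' = g'.
  by apply/funext => x; rewrite -[in LHS](g'K x) fK.
move: e g'c gK g'K => <- g'c gK g'K.
by congr Deck; exact: Prop_irrelevance.
Qed.

Definition deck_one : deck p.
Proof. by exists idfun idfun => // x. Defined.

Definition deck_mul g h : deck p.
Proof.
exists (g \o h) (deck_inv_fun h \o deck_inv_fun g).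
- by move=> x; apply: continuous_comp; exact: deck_continuous.
- by move=> x; apply: continuous_comp; exact: deck_inv_continuous.
- by move=> x /=; rewrite !deckK.
- by move=> x /=; rewrite !deckVK.
- by rewrite compA !deck_over.
Defined.

Definition deck_inv g : deck p.
Proof.
exists (deck_inv_fun g) g.
- exact: deck_inv_continuous.
- exact: deck_continuous.
- exact: deckVK.
- exact: deckK.
- by rewrite -{1}(deck_over g); apply/funext => x /=; rewrite deckVK.
Defined.

Lemma deck_mulA : associative deck_mul.
Proof. by move=> f g h; apply: deck_ext. Qed.
Lemma deck_mul1g : left_id deck_one deck_mul.
Proof. by move=> g; apply: deck_ext. Qed.
Lemma deck_mulg1 : right_id deck_one deck_mul.
Proof. by move=> g; apply: deck_ext. Qed.
Lemma deck_mulVg : left_inverse deck_one deck_inv deck_mul.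
Proof. by move=> g; apply: deck_ext; apply/funext => x /=; rewrite deckK. Qed.
Lemma deck_mulgV : right_inverse deck_one deck_inv deck_mul.
Proof. by move=> g; apply: deck_ext; apply/funext => x /=; rewrite deckVK. Qed.

HB.instance Definition _ := isGroup.Build (deck p)
  deck_mulA deck_mul1g deck_mulg1 deck_mulVg deck_mulgV.

End DeckGroup.

Definition min_nat (P : set nat) : \bar nat :=
  match pselect (exists k, `[< P k >]) with
  | left exP => (ex_minn exP)%:E
  | right _ => +oo%E
  end.

Definition Pi (R : realType) (X : topologicalType) : Type :=
  {eq_quot (@homotopic_rel R X)}.

Section PiTopology.
Context (R : realType) (X : topologicalType).
Local Notation path := (path_space R X).

HB.instance Definition _ := Choice.on (Pi R X).
HB.instance Definition _ := Quotient.on (Pi R X).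

Definition Pi_proj (f : path) : Pi R X := \pi_(Pi R X) f.

Definition Pi_basic (U V : set X) (f : path) : set (Pi R X) :=
  [set c | exists (d1 d2 : path) (e1 : d1 I1 = f I0)
             (e2 : concat e1 I1 = d2 I0),
     [/\ range d1 `<=` U, range d2 `<=` V & c = Pi_proj (concat e2)]].

Definition Pi_basis : set (set (Pi R X)) :=
  [set B | exists (U V : set X) (f : path),
     [/\ nice (R := R) U, nice (R := R) V, U (f I0), V (f I1) &
         B = Pi_basic U V f]].

(* The topology generated by the sets S(U, V, [f]); when X is good they are a
   basis of it. *)
HB.instance Definition _ := isSubBaseTopological.Build (Pi R X) Pi_basis id.

End PiTopology.

(* A local section over U j is given as a total function, of which only the
   restriction to U j matters: {within U j, continuous s} is continuity of that
   restriction, and every continuous map U j -> X^I extends to a total function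
   since Pi_proj is onto.  Likewise in TC_cover, by means of constant paths. *)
Definition AC_cover (R : realType) (X : topologicalType) (k : nat) : Prop :=
  exists U : 'I_k.+1 -> set (Pi R X),
    [/\ forall j, open (U j),
        \bigcup_j U j = setT &
        forall j, exists s : Pi R X -> path_space R X,
          {within U j, continuous s} /\ (forall c, U j c -> Pi_proj (s c) = c)].

Definition asphericity_complexity (R : realType) (X : topologicalType) :
    \bar nat :=
  min_nat (AC_cover R X).

Record gaction (G : groupType) (Z : topologicalType) : Type := GAction {
  gact :> G -> Z -> Z;
  gact1 : forall z, gact 1%g z = z;
  gactM : forall g h z, gact (g * h)%g z = gact g (gact h z);
  gact_continuous : forall g, continuous (gact g)
}.

Section EquivariantTC.
Context (R : realType) (G : groupType) (Z : topologicalType) (a : gaction G Z).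

Lemma gact_path_continuous (g : G) (f : path_space R Z) : continuous (a g \o f).
Proof.
move=> t; apply: continuous_comp; first exact: cts_fun.
exact: gact_continuous.
Qed.

Definition gact_path (g : G) (f : path_space R Z) : path_space R Z :=
  mkpath (gact_path_continuous (g := g) (f := f)).

Definition gact_pair (g : G) (z : Z * Z) : Z * Z := (a g z.1, a g z.2).

Definition path_ends (f : path_space R Z) : Z * Z := (f I0, f I1).

Definition TC_cover (k : nat) : Prop :=
  exists U : 'I_k.+1 -> set (Z * Z),
    [/\ forall j, open (U j),
        forall j g z, U j z -> U j (gact_pair g z),
        \bigcup_j U j = setT &
        forall j, exists s : Z * Z -> path_space R Z,
          [/\ {within U j, continuous s},
              forall g z, U j z -> s (gact_pair g z) = gact_path g (s z) &
              forall z, U j z -> path_ends (s z) = z]].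

Definition equivariant_TC : \bar nat := min_nat TC_cover.

End EquivariantTC.

Definition deck_action (E X : topologicalType) (p : E -> X) :
  gaction (deck p) E.
Proof.
exists (fun (g : deck p) (z : E) => g z) => //.
by move=> g; exact: deck_continuous.
Defined.

(* Main.v *)
(* Since E is simply connected, a pair (e, e') of points of E determines the
   homotopy class of the projection of any path from e to e'.  This gives a
   map from E x E to Pi(X) which is onto by path lifting, whose fibres are the
   orbits of the deck group, and which is continuous and open because small
   nice open sets of X lift to sheets; so Pi(X) is the orbit space of E x E.
   Invariant open covers of E x E therefore correspond to open covers of Pi(X).
   An equivariant section over E x E projects to a section over Pi(X);
   conversely, lifting the paths chosen by a section over Pi(X) from the first
   point of each pair gives an equivariant section, by uniqueness of lifts, and
   it is continuous by the homotopy lifting property. *)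
Require Import Defs.
From mathcomp Require Import all_boot all_order all_algebra.
From mathcomp Require Import all_classical all_reals all_analysis.
From mathcomp Require Import finmap lra.

Set Implicit Arguments.
Unset Strict Implicit.
Unset Printing Implicit Defensive.

Import Order.TTheory GRing.Theory Num.Theory.
Import numFieldNormedType.Exports.

Local Open Scope classical_set_scope.
Local Open Scope ring_scope.

(** * Preliminaries on neighbourhoods and products *)

Lemma open_nbhs_at (T : topologicalType) (A : set T) x :
  open A -> A x -> nbhs x A.
Proof. by move=> oA Ax; exact: open_nbhs_nbhs. Qed.

Lemma pairr_continuous (S T : topologicalType) (t : T) :
  continuous (fun s : S => (s, t)).
Proof.
apply: (@pair_continuous S S T idfun (cst t)); last exact: cst_continuous.
by move=> s; exact: cvg_id.
Qed.

Lemma swap_continuous (S T : topologicalType) :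
  continuous (fun z : S * T => (z.2, z.1)).
Proof.
by apply: (@pair_continuous (S * T)%type T S snd fst) => z;
  [exact: cvg_snd|exact: cvg_fst].
Qed.

(** * The unit interval *)

Section Interval.
Context {R : realType}.
Local Notation I := (unit_interval R).

Lemma unit_interval_connected : connected [set: I].
Proof.
have -> : [set: I] = clamp @` `[0, 1 : R].
  apply/seteqP; split=> // t _; exists (ival t); last exact: ivalK.
  by rewrite /= in_itv /= ival_ge0 ival_le1.
apply: connected_continuous_connected; first exact: segment_connected.
by apply: continuous_subspaceT => x; exact: clamp_continuous.
Qed.

(** The local hypothesis is symmetric in [a] and [b], so both the set where [P] holds and its
    complement are open, and connectedness concludes. It replaces subdivision of the interval in the
    lifting proofs. *)
Lemma unit_interval_ind (P : I -> Prop) (t0 : I) :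
  P t0 ->
  (forall t : I, exists2 W : set I, nbhs t W &
     forall a b, W a -> W b -> P a -> P b) ->
  forall t, P t.
Proof.
move=> Pt0 loc; suff : [set t | P t] = setT.
  by move=> e t; rewrite -[P t]/([set t | P t] t) e.
have oP : open [set t | P t].
  rewrite openE => t /= Pt; have [W Wt PW] := loc t.
  by apply: filterS (Wt) => b Wb; exact: (PW t b (nbhs_singleton Wt) Wb Pt).
have oPC : open (~` [set t | P t]).
  rewrite openE => t /= Pt; have [W Wt PW] := loc t.
  apply: filterS (Wt) => b Wb Pb; apply: Pt.
  exact: (PW b t Wb (nbhs_singleton Wt) Pb).
apply: unit_interval_connected; first by exists t0.
  by exists [set t | P t]; rewrite ?setTI.
by exists [set t | P t]; rewrite ?setTI //; rewrite -openC.
Qed.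

(** * Subintervals and local compactness of the unit interval *)

Definition near_itv (t : I) (e : R) : set I :=
  [set s | `|ival s - ival t| < e].

Lemma nbhs_near_itv (t : I) (e : R) : 0 < e -> nbhs t (near_itv t e).
Proof.
move=> e0; have := @ival_continuous R t.
move=> /cvgrPdist_lt /(_ _ e0); apply: filterS => s /=.
by rewrite /near_itv /= distrC.
Qed.

Lemma open_near_itv (t : I) (e : R) : open (near_itv t e).
Proof.
rewrite openE => s /= st.
have e'0 : 0 < e - `|ival s - ival t| by rewrite subr_gt0.
apply: filterS (nbhs_near_itv s e'0) => r; rewrite /near_itv /= => rs.
have -> : ival r - ival t = (ival r - ival s) + (ival s - ival t) by lra.
by apply: (le_lt_trans (ler_normD _ _)); lra.
Qed.

Lemma near_itvP (t : I) (W : set I) :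
  nbhs t W -> exists2 e : R, 0 < e & near_itv t e `<=` W.
Proof.
move=> Wt; have := @clamp_continuous R (ival t); rewrite /continuous_at ivalK.
move=> /(_ _ Wt) /= /nbhs_ballP [e /= e0 eW]; exists e => // s st.
rewrite -[s]ivalK; apply: eW; rewrite /ball /= distrC; exact: st.
Qed.

Definition itv_between (a b s : I) : I :=
  clamp ((ival b - ival a) * ival s + ival a).

Lemma ival_between (a b s : I) :
  ival (itv_between a b s) = (ival b - ival a) * ival s + ival a.
Proof.
have := ival_ge0 a; have := ival_ge0 b; have := ival_ge0 s.
have := ival_le1 a; have := ival_le1 b; have := ival_le1 s.
by move=> *; apply: clampK; nra.
Qed.

Lemma itv_between_continuous a b : continuous (itv_between a b).
Proof. by apply: clamp_affine_continuous; exact: ival_continuous. Qed.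

Lemma itv_between0 a b : itv_between a b I0 = a.
Proof. by apply: ival_inj; rewrite ival_between ival0; lra. Qed.

Lemma itv_between1 a b : itv_between a b I1 = b.
Proof. by apply: ival_inj; rewrite ival_between ival1; lra. Qed.

Lemma near_itv_convex (t : I) e a b c : near_itv t e a -> near_itv t e b ->
  ival a <= ival c -> ival c <= ival b -> near_itv t e c.
Proof.
rewrite /near_itv /= !ltr_norml => /andP[? ?] /andP[? ?] ? ?.
by apply/andP; split; lra.
Qed.

Lemma near_itv_between (t : I) e a b s : near_itv t e a -> near_itv t e b ->
  near_itv t e (itv_between a b s).
Proof.
move=> ha hb; have s0 := ival_ge0 s; have s1 := ival_le1 s.
have [ab|ba] := leP (ival a) (ival b).
  by apply: (near_itv_convex ha hb); rewrite ival_between; nra.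
by apply: (near_itv_convex hb ha); rewrite ival_between; nra.
Qed.

Definition itv_min (t s : I) : I := if ival s <= ival t then s else t.
Definition itv_max (t s : I) : I := if ival s <= ival t then t else s.

Lemma itv_min_continuous t : continuous (itv_min t).
Proof.
apply: (@piecewise_continuous R I I ival (ival t) idfun (cst t)).
- exact: ival_continuous.
- by move=> x; exact: cvg_id.
- exact: cst_continuous.
- by move=> x /ival_inj.
Qed.

Lemma itv_max_continuous t : continuous (itv_max t).
Proof.
apply: (@piecewise_continuous R I I ival (ival t) (cst t) idfun).
- exact: ival_continuous.
- exact: cst_continuous.
- by move=> x; exact: cvg_id.
- by move=> x /ival_inj.
Qed.

Lemma compact_near_itv (t : I) (W : set I) : nbhs t W ->
  exists K : set I, [/\ compact K, nbhs t K & K `<=` W].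
Proof.
move=> /near_itvP [e e0 eW].
have e20 : 0 < e / 2 by lra.
exists (clamp @` `[Num.max 0 (ival t - e / 2), Num.min 1 (ival t + e / 2)]).
split.
- apply: continuous_compact; last exact: segment_compact.
  by apply: continuous_subspaceT => x; exact: clamp_continuous.
- apply: filterS (nbhs_near_itv t e20) => s; rewrite /near_itv /= => st.
  exists (ival s); last exact: ivalK.
  rewrite /= in_itv /= ge_max le_min ival_ge0 ival_le1 /=.
  by move: st; rewrite ltr_norml => /andP[? ?]; apply/andP; split; lra.
- move=> _ [r /= + <-]; rewrite in_itv /= ge_max le_min.
  move=> /andP[/andP[r0 rt] /andP[r1 tr]]; apply: eW.
  by rewrite /near_itv /= clampK // ltr_norml; apply/andP; split; lra.
Qed.

End Interval.

(** * Covering maps and lifting *)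

Section CoveringSheets.
Context (E X : topologicalType) (p : E -> X).

(** The section is a total map, meaningful on [U] only. Openness of the rest of the preimage makes
    [V] clopen over [U], which is what confines paths to it. *)
Record sheet (U : set X) (V : set E) (sec : X -> E) : Prop := Sheet {
  sheet_open : open V;
  sheet_compl_open : open (p @^-1` U `\` V);
  sheet_sub : V `<=` p @^-1` U;
  sheet_sec : forall x, U x -> V (sec x);
  sheet_secK : forall x, U x -> p (sec x) = x;
  sheet_projK : forall e, V e -> sec (p e) = e;
  sheet_sec_continuous : forall x, U x -> {for x, continuous sec}
}.

Lemma covering_sheet : covering_map p -> forall x : X,
  exists2 U : set X, open_nbhs x U &
  forall e, U (p e) -> exists V sec, sheet U V sec /\ V e.
Proof.
case=> pc _ ev x; have [U Ux [J [V [Vo Vt VU Vh]]]] := ev x.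
exists U => // e Upe.
have [j _ Vje] : (\bigcup_j V j) e by rewrite -VU.
have [_ [_ inj _] [g [gc gp]]] := Vh j.
have oU : open U by case: Ux.
have pV : V j `<=` p @^-1` U by move=> a Va; rewrite VU; exists j.
(* The inverse of [p] on the sheet is made total; its value [e] off [U] is arbitrary. *)
pose sec u :=
  if pselect (u \in U) is left uU then set_val (g (SigSub uU)) else e.
have secE u (uU : u \in U) : sec u = set_val (g (SigSub uU)).
  rewrite /sec; case: pselect => // uU'.
  by rewrite (_ : uU' = uU) //; exact: Prop_irrelevance.
have secV u : U u -> V j (sec u).
  by move=> /mem_set uU; rewrite secE; exact: set_mem (valP (g (SigSub uU))).
have secK u : U u -> p (sec u) = u.
  by move=> /mem_set uU; rewrite secE gp.
exists (V j), sec; split => //; split => //.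
(* What remains of the preimage is the union of the other sheets, by disjointness. *)
- rewrite (_ : _ `\` _ = \bigcup_(k in [set k | k <> j]) V k).
    by apply: bigcup_open => k _; exact: Vo.
  apply/seteqP; split=> a.
    move=> [+ nVja]; rewrite VU => -[k _ Vka]; exists k => //= kj; apply: nVja.
    by rewrite -kj.
  move=> [k /= kj Vka]; split.
    by rewrite /= -[U (p a)]/((p @^-1` U) a) VU; exists k.
  by move=> Vja; apply: kj; apply: Vt => //; exists a.
- move=> a Va; have Upa := pV _ Va.
  by apply: inj; [exact/mem_set/secV|exact: mem_set|rewrite secK].
- move=> u Uu; have uU := mem_set Uu.
  move=> W; rewrite secE => Wn.
  have vc : continuous (set_val : set_type (V j) -> E).
    exact: initial_continuous.
  have := gc (SigSub uU) _ (vc _ _ Wn).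
  move=> [_ [[A oA <-] /= Au AW]].
  (* Openness of [U] turns the trace of [A] on [U] into a neighbourhood in [X]. *)
  have : nbhs u (A `&` U) by apply: open_nbhs_nbhs; split; [exact: openI|].
  apply: filterS => v [Av Uv]; have vU := mem_set Uv.
  by rewrite /= secE; exact: AW.
Qed.

End CoveringSheets.

Section Lifting.
Context {R : realType} (E X : topologicalType) (p : E -> X).
Hypothesis pcov : covering_map p.
Local Notation I := (unit_interval R).

Lemma covering_continuous : continuous p. Proof. by case: pcov. Qed.

Lemma clopen_path (A V : set E) (f : I -> E) t0 :
  open V -> open (A `\` V) -> continuous f -> (forall t, A (f t)) ->
  V (f t0) -> forall t, V (f t).
Proof.
move=> oV oAV fc fA Vf0; apply: (unit_interval_ind Vf0) => t.
have [Vt|nVt] := pselect (V (f t)).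
  by exists (f @^-1` V) => //; apply: fc; exact: open_nbhs_at.
exists (f @^-1` (A `\` V)); last by move=> a b [_ nVa] _ Va.
by apply: fc; apply: open_nbhs_at.
Qed.

(** Near a given time, either both lifts lie in one sheet, where [p] is injective, and they agree;
    or [f] lies in a sheet that [g] avoids, and they never agree. *)
Lemma unique_lift (f g : I -> E) t0 : continuous f -> continuous g ->
  p \o f = p \o g -> f t0 = g t0 -> f = g.
Proof.
move=> fc gc fg fg0.
have fgE t : p (f t) = p (g t) by exact: (congr1 (@^~ t) fg).
apply/funext; apply: (unit_interval_ind fg0) => t.
have [U [oU Ut] /(_ _ Ut) [V [sec [sV Vf]]]] := covering_sheet pcov (p (f t)).
have oV := sheet_open sV; have oUV := sheet_compl_open sV.
have fV : nbhs t (f @^-1` V) by apply: fc; exact: open_nbhs_at.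
have [Vg|nVg] := pselect (V (g t)).
  have gV : nbhs t (g @^-1` V) by apply: gc; exact: open_nbhs_at.
  exists (f @^-1` V `&` g @^-1` V); first exact: filterI.
  move=> a b _ [/= Vfb Vgb] _.
  by rewrite -(sheet_projK sV Vfb) -(sheet_projK sV Vgb) fgE.
have gV : nbhs t (g @^-1` (p @^-1` U `\` V)).
  by apply: gc; apply: open_nbhs_at => //; split => //=; rewrite -fgE.
exists (f @^-1` V `&` g @^-1` (p @^-1` U `\` V)); first exact: filterI.
by move=> a b [/= Vfa [_ nVga]] _ e; case: nVga; rewrite -e.
Qed.

Lemma sec_comp_continuous (T : topologicalType) U V sec (f : T -> X) :
  sheet p U V sec -> continuous f -> (forall t, U (f t)) ->
  continuous (sec \o f).
Proof.
move=> sV fc fU t; apply: continuous_comp; first exact: fc.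
exact: sheet_sec_continuous sV _ (fU t).
Qed.

Lemma path_lifting (f : path_space R X) (e : E) : p e = f I0 ->
  exists2 h : path_space R E, h I0 = e & forall t, p (h t) = f t.
Proof.
move=> pe.
(* [P t] says that [f] stopped at time [t] lifts; stopping keeps every path defined on the whole
   interval. *)
pose P t := exists2 h : path_space R E, h I0 = e &
  forall s, p (h s) = f (itv_min t s).
suff : P I1.
  move=> [h h0 hp]; exists h => // t; rewrite hp /itv_min ival1 ival_le1 //.
have P0 : P I0.
  exists (const_path e) => // s; rewrite /itv_min /= pe; congr (f _).
  case: ifP => // s0; apply: ival_inj; apply/eqP.
  by rewrite eq_le s0 ival0 ival_ge0.
apply: (unit_interval_ind P0) => t.
have [U [oU Ut] sh] := covering_sheet pcov (f t).
have /near_itvP [r r0 rU] : nbhs t (f @^-1` U).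
  by apply: (@cts_fun _ _ f t); exact: open_nbhs_at.
exists (near_itv t r); first exact: nbhs_near_itv.
move=> a b ta tb [h h0 hp].
(* Going back in time, the lift is stopped earlier; going forward, it is prolonged through a
   sheet. *)
have [ba|ab] := leP (ival b) (ival a).
  have hc : continuous (h \o itv_min b).
    move=> s; apply: continuous_comp; last exact: cts_fun.
    exact: itv_min_continuous.
  exists (mkpath hc) => [|s] /=.
    by rewrite /mkcts /= /itv_min ival0 ival_ge0.
  rewrite /mkcts /= hp; congr (f _); rewrite /itv_min.
  by case: (leP (ival s) (ival b)) => [sb|_]; rewrite ?(le_trans sb ba) ?ba.
have pha : p (h a) = f a by rewrite hp /itv_min lexx.
have /sh [V [sec [sV Vh]]] : U (p (h a)) by rewrite pha; exact: rU.
(* Forcing the time into [a, b] keeps [f \o m] inside [U] at all times, so [sec] composes with it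
   continuously; only the part after [a] is used. *)
pose m s := itv_max a (itv_min b s).
have mU s : U (f (m s)).
  apply: rU; apply: (near_itv_convex ta tb); rewrite /m /itv_max /itv_min.
    by case: ifP => // /negbT; rewrite -ltNge => /ltW.
  by case: ifP => // _; [exact: ltW|case: ifP].
have mc : continuous (f \o m).
  move=> s; apply: continuous_comp; last exact: cts_fun.
  apply: continuous_comp; first exact: itv_min_continuous.
  exact: itv_max_continuous.
have hc : continuous
    (fun s => if ival s <= ival a then h s else (sec \o (f \o m)) s).
  apply: piecewise_continuous.
  - exact: ival_continuous.
  - by move=> s; exact: cts_fun.
  - exact: sec_comp_continuous sV mc mU.
  - move=> s /ival_inj -> /=.
    rewrite /m /itv_min (ltW ab) /itv_max lexx -pha.
    by rewrite (sheet_projK sV Vh).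
exists (mkpath hc) => [|s] /=; rewrite /mkcts /=.
  by rewrite ival0 ival_ge0.
case: ifPn => sa.
  by rewrite hp /itv_min sa (le_trans sa (ltW ab)).
rewrite (sheet_secK sV) //; congr (f _); rewrite /m /itv_max ifN // /itv_min.
by case: ifP => _ //; rewrite -ltNge.
Qed.

(* The homotopy lifting property, stated pointwise in [Y] *)
Lemma lift_jointly_continuous (Y : topologicalType) (y0 : Y) (F : Y -> I -> E) :
  (forall y, continuous (F y)) ->
  (forall t, {for (y0, t), continuous (fun z => p (F z.1 z.2))}) ->
  {for y0, continuous (F^~ I0)} ->
  forall t, {for (y0, t), continuous (fun z => F z.1 z.2)}.
Proof.
move=> Fc pFc F0.
pose P t := {for y0, continuous (F^~ t)}.
(* Continuity in [y] at the single time [a] puts [F y a] in one sheet for [y] near [y0]. The path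
   [F y] then stays in that sheet at nearby times, where [F] is [sec] applied to its projection. *)
have loc (t : I) : exists2 W : set I, nbhs t W &
    forall a b, W a -> W b -> P a ->
    {for (y0, b), continuous (fun z => F z.1 z.2)}.
  have [U [oU Ut] sh] := covering_sheet pcov (p (F y0 t)).
  have [[N M] /= [Ny0 Mt] NMU] := pFc t _ (open_nbhs_at oU Ut).
  have [r r0 rM] := near_itvP Mt.
  exists (near_itv t r); first exact: nbhs_near_itv.
  move=> a b ta tb Pa.
  have NU y s : N y -> near_itv t r s -> U (p (F y s)).
    by move=> Ny ts; apply: (NMU (y, s)); split => //; exact: rM.
  have /sh [V [sec [sV Vy0]]] := NU y0 a (nbhs_singleton Ny0) ta.
  have N'y0 : nbhs y0 (N `&` [set y | V (F y a)]).
    by apply: filterI => //; apply: Pa; exact: open_nbhs_at (sheet_open sV) _.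
  have FV y s : (N `&` [set y | V (F y a)]) y -> near_itv t r s -> V (F y s).
    move=> [Ny Va] ts; rewrite -(itv_between1 a s).
    apply: (@clopen_path (p @^-1` U) V (F y \o itv_between a s) I0).
    - exact: sheet_open sV.
    - exact: sheet_compl_open sV.
    - move=> u; apply: continuous_comp; last exact: Fc.
      exact: itv_between_continuous.
    - by move=> u; apply: NU => //; exact: near_itv_between.
    - by rewrite /= itv_between0.
  have FE y s : (N `&` [set y | V (F y a)]) y -> near_itv t r s ->
      sec (p (F y s)) = F y s.
    by move=> Ny ts; apply: (sheet_projK sV); exact: FV.
  have secc : {for (y0, b), continuous (sec \o (fun z => p (F z.1 z.2)))}.
    apply: continuous_comp; first exact: pFc.
    by apply: (sheet_sec_continuous sV); apply: NU => //; exact: nbhs_singleton.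
  move=> B; rewrite /= -(FE y0 b (nbhs_singleton N'y0) tb) => /secc secB.
  have nb : nbhs (y0, b) ((N `&` [set y | V (F y a)]) `*` near_itv t r).
    by exists (N `&` [set y | V (F y a)], near_itv t r) => //; split => //=;
      apply: open_nbhs_at => //; exact: open_near_itv.
  apply: filterS2 nb secB => -[y s] [/= Ny ts].
  by rewrite /preimage /= FE.
have PT : forall t, P t.
  apply: (@unit_interval_ind _ _ I0) => // t; have [W Wt PW] := loc t.
  exists W => // a b Wa Wb Pa.
  apply: (@continuous_comp _ _ _ (fun y => (y, b)) (fun z => F z.1 z.2)).
    exact: pairr_continuous.
  exact: (PW a b Wa Wb Pa).
move=> t; have [W Wt PW] := loc t.
exact: (PW t t (nbhs_singleton Wt) (nbhs_singleton Wt) (PT t)).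
Qed.

(** Each stage of the homotopy is lifted from [f I0]. The endpoints of these lifts vary continuously
    and lie over one point, hence are constant by uniqueness of lifts; the extreme stages lift to
    [f] and [g]. *)
Lemma homotopic_lift_end (f g : path_space R E) (f' g' : path_space R X) :
  homotopic f' g' -> (forall t, p (f t) = f' t) -> (forall t, p (g t) = g' t) ->
  f I0 = g I0 -> f I1 = g I1.
Proof.
move=> [H [Hc H0 H1 Hl Hr]] ff' gg' fg0.
have Hsc s : continuous (fun t => H (t, s)).
  move=> t; apply: (@continuous_comp _ _ _ (fun t => (t, s)) H); last exact: Hc.
  exact: pairr_continuous.
have lift s : {h : path_space R E | h I0 = f I0 & forall t, p (h t) = H (t, s)}.
  apply: cid2; apply: (@path_lifting (mkpath (Hsc s))).
  by rewrite ff' /= /mkcts Hl.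
pose F s := s2val (lift s).
have F0 s : F s I0 = f I0 by exact: (s2valP (lift s)).
have pF s t : p (F s t) = H (t, s) by exact: (s2valP' (lift s) t).
have Fc s : continuous (F s) by exact: cts_fun.
have Fj t s : {for (s, t), continuous (fun z => F z.1 z.2)}.
  apply: (@lift_jointly_continuous _ s F) => // [u|].
    rewrite (_ : (fun z => p (F z.1 z.2)) = H \o (fun z : I * I => (z.2, z.1))).
      by apply: continuous_comp; [exact: swap_continuous|exact: Hc].
    by apply/funext => z; rewrite pF.
  by rewrite (_ : F^~ I0 = cst (f I0)); [exact: cst_continuous|exact/funext].
have F1c : continuous (F^~ I1).
  move=> s.
  apply: (@continuous_comp _ _ _ (fun s => (s, I1)) (fun z => F z.1 z.2)).
    exact: pairr_continuous.
  exact: Fj.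
have e1 : F^~ I1 = cst (F I0 I1).
  apply: (@unique_lift _ _ I0) => //; first exact: cst_continuous.
  by apply/funext => s; rewrite /= !pF !Hr.
have -> : f I1 = F I0 I1.
  congr (_ I1); apply: (@unique_lift _ _ I0);
    [exact: cts_fun|exact: Fc| |by rewrite F0].
  by apply/funext => t /=; rewrite pF H0 ff'.
have -> : g I1 = F I1 I1.
  congr (_ I1); apply: (@unique_lift _ _ I0);
    [exact: cts_fun|exact: Fc| |by rewrite F0].
  by apply/funext => t /=; rewrite pF H1 gg'.
exact: esym (congr1 (@^~ I1) e1).
Qed.

End Lifting.

(** * Homotopies of paths *)

Section PathOperations.
Context {R : realType} {X : topologicalType}.
Local Notation I := (unit_interval R).
Local Notation path := (path_space R X).
Implicit Types f g : path.

Lemma path_ext f g : (forall t, f t = g t) -> f = g.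
Proof. by move=> fg; apply/continuousEP. Qed.

Lemma mkpathE (f : I -> X) (fc : continuous f) t : mkpath fc t = f t.
Proof. by []. Qed.

Lemma range_sub f (A : set X) : range f `<=` A <-> forall t, A (f t).
Proof. by split=> [fA t|fA _ [t _ <-]] //; apply: fA; exists t. Qed.

Lemma rev_continuous f : continuous (fun t : I => f (clamp (- 1 * ival t + 1))).
Proof.
move=> t; apply: (@continuous_comp _ _ _ (fun t => clamp (- 1 * ival t + 1)) f).
  by apply: clamp_affine_continuous; exact: ival_continuous.
exact: cts_fun.
Qed.

Definition reverse_path f : path := mkpath (@rev_continuous f).

Lemma reverse_pathE f t : reverse_path f t = f (clamp (1 - ival t)).
Proof. by rewrite /reverse_path /= /mkcts mulN1r addrC. Qed.

Lemma reverse_path0 f : reverse_path f I0 = f I1.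
Proof. by rewrite reverse_pathE ival0 subr0. Qed.

Lemma reverse_path1 f : reverse_path f I1 = f I0.
Proof. by rewrite reverse_pathE ival1 subrr. Qed.

Lemma concatE f g (fg : f I1 = g I0) t : concat fg t = concat_fun f g t.
Proof. by []. Qed.

Lemma concat_0 f g (fg : f I1 = g I0) : concat fg I0 = f I0.
Proof.
by rewrite concatE /concat_fun ival0 invr_ge0 ler0n mulr0.
Qed.

Lemma concat_sub f g (fg : f I1 = g I0) (A : set X) :
  (forall t, A (f t)) -> (forall t, A (g t)) -> forall t, A (concat fg t).
Proof. by move=> fA gA t; rewrite concatE /concat_fun; case: ifP. Qed.

(** The loop [l] is [f] followed by the reverse of [g]. Its null homotopy fills a square that is
    constant on three sides, and convexity of the square lets the two halves of the fourth side be
    compared. *)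
Lemma homotopic_of_loop f g (l : path) :
  (forall t, l (clamp (2^-1 * ival t)) = f t) ->
  (forall t, l (clamp (1 - 2^-1 * ival t)) = g t) ->
  homotopic l (const_path (f I0)) -> homotopic f g.
Proof.
move=> lf lg [H [Hc H0 H1 Hl Hr]].
have l0 : l I0 = f I0 by rewrite -lf ival0 mulr0.
have l1 : l I1 = f I0 by rewrite -(Hr I1) H1.
have l12 : l (clamp 2^-1) = f I1 by rewrite -lf ival1 mulr1.
(* The point (a s, b s) runs up the left side of the square, along the top and down the right side,
   one third of the time each; [H] is constant there. *)
pose a (s : I) : R := ival (clamp (3 * ival s - 1) : I).
pose b (s : I) : R :=
  ival (clamp (3 * ival s + 0) : I) * ival (clamp (- 3 * ival s + 3) : I).
have cc (x y : R) : continuous (fun s : I => ival (clamp (x * ival s + y) : I)).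
  move=> s.
  apply: (@continuous_comp I I R (fun s : I => clamp (x * ival s + y)) ival).
    by apply: clamp_affine_continuous; exact: ival_continuous.
  exact: ival_continuous.
have ac : continuous a by exact: cc.
have bc : continuous b.
  move=> s; exact: (@cvgM _ _ _ _
    (fun s : I => ival (clamp (3 * ival s + 0) : I))
    (fun s : I => ival (clamp (- 3 * ival s + 3) : I))
    _ _ (cc 3 0 s) (cc (- 3) 3 s)).
have Hab s : H (clamp (a s), clamp (b s)) = f I0.
  have s0 := ival_ge0 s; have s1 := ival_le1 s.
  have [s13|s13] := leP (3 * ival s) 1.
    rewrite (_ : clamp (a s) = I0) ?Hl //; congr clamp.
    by rewrite /a clampE; apply: max_l; rewrite ge_min; apply/orP; left; lra.
  have [s23|s23] := leP 2 (3 * ival s).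
    rewrite (_ : clamp (a s) = I1) ?Hr ?l1 //; congr clamp.
    by rewrite /a clampE min_r ?max_r; lra.
  rewrite (_ : clamp (b s) = I1) ?H1 //; congr clamp.
  by rewrite /b !clampE !(min_r, max_r) ?mulr1; lra.
pose u (z : I * I) : R := 2^-1 * ival z.1 + (1 - ival z.1) * a z.2.
pose v (z : I * I) : R := (1 - ival z.1) * b z.2.
have fstc : continuous (fun z : I * I => ival z.1).
  move=> z; apply: (@continuous_comp _ _ _ fst ival); first exact: cvg_fst.
  exact: ival_continuous.
have onefc : continuous (fun z : I * I => 1 - ival z.1).
  by move=> z; apply: cvgB; [exact: cvg_cst|exact: fstc].
have uc : continuous u.
  move=> z; apply: cvgD; apply: cvgM;
    [exact: cvg_cst|exact: fstc|exact: onefc|].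
  by apply: (@continuous_comp _ _ _ snd a); [exact: cvg_snd|exact: ac].
have vc : continuous v.
  move=> z; apply: cvgM; [exact: onefc|].
  by apply: (@continuous_comp _ _ _ snd b); [exact: cvg_snd|exact: bc].
(* [H] precomposed with the straight-line homotopy, in the square, from the
   left half of the bottom side to the path which runs along the left, top and
   right sides and then back to the midpoint of the bottom side. *)
exists (fun z => H (clamp (u z), clamp (v z))); split.
- move=> z.
  apply: (@continuous_comp _ _ _ (fun z => (clamp (u z), clamp (v z))) H).
    by apply: pair_continuous => w; apply: continuous_comp;
      [exact: uc|exact: clamp_continuous|exact: vc|exact: clamp_continuous].
  exact: Hc.
- move=> t; rewrite /u /v /=.
  have -> : a I0 = 0.
    rewrite /a ival0 clampE; apply: max_l.
    by rewrite ge_min; apply/orP; left; lra.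
  have -> : b I0 = 0 by rewrite /b ival0 mulr0 addr0 ival0 mul0r.
  by rewrite !mulr0 addr0 H0.
- move=> t; rewrite /u /v /=.
  have -> : a I1 = 1 by rewrite /a ival1 clampE min_r ?max_r; lra.
  have -> : b I1 = 0.
    by rewrite /b ival1 !mulr1 addNr ival0 mulr0.
  rewrite !mulr0 mulr1 H0 -lg; congr (l (clamp _)); lra.
- by move=> s; rewrite /u /v /= ival0 mulr0 add0r subr0 !mul1r Hab.
- by move=> s; rewrite /u /v /= ival1 subrr !mul0r addr0 mulr1 H0.
Qed.

Lemma simply_connected_homotopic : simply_connected R X ->
  forall f g, f I0 = g I0 -> f I1 = g I1 -> homotopic f g.
Proof.
move=> [_ X1] f g fg0 fg1.
have fg : f I1 = reverse_path g I0 by rewrite reverse_path0.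
apply: (@homotopic_of_loop f g (concat fg)).
- move=> t; have t0 := ival_ge0 t; have t1 := ival_le1 t.
  rewrite concatE /concat_fun clampK; [|lra..].
  rewrite ifT; last lra.
  by congr (f _); rewrite mulrA mulfV ?mul1r ?ivalK ?pnatr_eq0.
- move=> t; have t0 := ival_ge0 t; have t1 := ival_le1 t.
  rewrite concatE /concat_fun clampK; [|lra..].
  case: ifPn => h.
    (* At the midpoint the concatenation still follows [f]; the common endpoint reconciles it with
       [g]. *)
    have -> : t = I1 by apply: ival_inj; rewrite ival1; lra.
    by rewrite -fg1; congr (f _); rewrite ival1; congr clamp; lra.
  rewrite reverse_pathE; congr (g _); rewrite clampK; [|lra..].
  by rewrite -[RHS]ivalK; congr clamp; lra.
- apply: X1 => //; first exact: concat_0.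
    by rewrite concat_1 reverse_path1.
Qed.

End PathOperations.

Section MapPath.
Context {R : realType} {X Y : topologicalType} (h : X -> Y).
Hypothesis hc : continuous h.

Lemma push_path_continuous (f : path_space R X) : continuous (h \o f).
Proof. by move=> t; apply: continuous_comp; [exact: cts_fun|exact: hc]. Qed.

Definition push_path (f : path_space R X) : path_space R Y :=
  mkpath (@push_path_continuous f).

Lemma push_pathE f t : push_path f t = h (f t). Proof. by []. Qed.

Lemma homotopic_push f g :
  homotopic f g -> homotopic (push_path f) (push_path g).
Proof.
move=> [H [Hc H0 H1 Hl Hr]]; exists (h \o H); split.
- by move=> z; apply: continuous_comp; [exact: Hc|exact: hc].
- by move=> t; rewrite /= H0.
- by move=> t; rewrite /= H1.
- by move=> t; rewrite /= Hl.
- by move=> t; rewrite /= Hr.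
Qed.

End MapPath.

(** * The homotopy class determined by a pair of points of the cover *)

Section UniversalCover.
Context {R : realType} (E X : topologicalType) (p : E -> X).
Hypothesis lpcX : locally_path_connected R X.
Hypothesis pcov : covering_map p.
Hypothesis scE : simply_connected R E.
Local Notation I := (unit_interval R).
Local Notation pc := (covering_continuous pcov).
Local Notation pmap := (@push_path R E X p pc).

Lemma cover_surj x : exists e, p e = x.
Proof. by case: pcov => _ ps _; have [e _ <-] := ps x Logic.I; exists e. Qed.

Lemma path_between (e e' : E) :
  exists2 f : path_space R E, f I0 = e & f I1 = e'.
Proof.
by have [f [f0 f1 _]] := proj1 scE e e' Logic.I Logic.I; exists f.
Qed.

Lemma cover_locally_path_connected (e : E) (N : set E) : nbhs e N ->
  exists2 N' : set E, nbhs e N' & forall e', N' e' ->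
    exists f : path_space R E, [/\ f I0 = e, f I1 = e' & forall t, N (f t)].
Proof.
move=> Ne.
have [U [oU Ut] /(_ _ Ut) [V [sec [sV Ve]]]] := covering_sheet pcov (p e).
have secN : nbhs (p e) (U `&` sec @^-1` N).
  apply: filterI; first exact: open_nbhs_nbhs.
  by apply: (sheet_sec_continuous sV Ut); rewrite (sheet_projK sV Ve).
have [U' [[oU' U'e] U'pc U'N]] := lpcX secN.
exists (V `&` p @^-1` U').
  apply: filterI; first exact: open_nbhs_at (sheet_open sV) Ve.
  by apply: pc; exact: open_nbhs_nbhs.
move=> e' [Ve' U'e'].
have [f [f0 f1 /range_sub fU']] := U'pc _ _ U'e U'e'.
have fc : continuous (sec \o f).
  apply: sec_comp_continuous sV _ _; first exact: cts_fun.
  by move=> t; have [] := U'N _ (fU' t).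
exists (mkpath fc); split; try (move=> t); rewrite mkpathE /=.
- by rewrite f0 (sheet_projK sV Ve).
- by rewrite f1 (sheet_projK sV Ve').
- by have [] := U'N _ (fU' t).
Qed.

(** Inside an evenly covered set, loops lift through the section to loops of the simply connected
    [E], so they are null-homotopic below. A path over [U] through [e] stays in its sheet, hence
    equals the section of its projection, which lies in [N]. *)
Lemma nice_nbhs (e : E) (N : set E) : nbhs e N ->
  exists U : set X, [/\ nice (R := R) U, U (p e) &
    forall (d : path_space R E) t0, (forall t, U (p (d t))) -> d t0 = e ->
      forall t, N (d t)].
Proof.
move=> Ne.
have [U [oU Ut] /(_ _ Ut) [V [sec [sV Ve]]]] := covering_sheet pcov (p e).
have secN : nbhs (p e) (U `&` sec @^-1` N).
  apply: filterI; first exact: open_nbhs_nbhs.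
  by apply: (sheet_sec_continuous sV Ut); rewrite (sheet_projK sV Ve).
have [U' [[oU' U'e] U'pc U'N]] := lpcX secN.
exists U'; split => //.
- split => // x U'x f f0 f1 /range_sub fU'.
  have fU t : U (f t) by have [] := U'N _ (fU' t).
  have fc : continuous (sec \o f).
    by apply: sec_comp_continuous sV _ _ => //; exact: cts_fun.
  have -> : f = pmap (mkpath fc).
    by apply: path_ext => t; rewrite push_pathE mkpathE /= (sheet_secK sV).
  have -> : const_path x = pmap (const_path (sec x)).
    apply: path_ext => t; rewrite push_pathE /= (sheet_secK sV) //.
    by have [] := U'N _ U'x.
  by apply: homotopic_push; apply: (proj2 scE) => //;
    rewrite mkpathE /= ?f0 ?f1.
- move=> d t0 dU' d0 t.
  have dU s : U (p (d s)) by have [] := U'N _ (dU' s).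
  have dV : V (d t).
    apply: (@clopen_path _ _ (p @^-1` U) V d t0) => //.
    + exact: sheet_open sV.
    + exact: sheet_compl_open sV.
    + exact: cts_fun.
    + by rewrite d0.
  by rewrite -(sheet_projK sV dV); have [] := U'N _ (dU' t).
Qed.

(* [deck_graph e e' x x'] says that the deck transformation taking [e] to [e']
   takes [x] to [x']. *)
Definition deck_graph (e e' x x' : E) : Prop :=
  exists f h : path_space R E,
    [/\ f I0 = e, f I1 = x, h I0 = e', h I1 = x' & forall t, p (h t) = p (f t)].

Lemma deck_graph_sym e e' x x' : deck_graph e e' x x' -> deck_graph e' e x' x.
Proof. by move=> [f [h [? ? ? ? hf]]]; exists h, f; split. Qed.

(** Any two paths from [e] to [x] are homotopic in [E], so the lifts of their projections from [e']
    end together. *)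
Lemma deck_graph_fun e e' x x1 x2 :
  deck_graph e e' x x1 -> deck_graph e e' x x2 -> x1 = x2.
Proof.
move=> [f [h [f0 f1 h0 <- hf]]] [f' [h' [f'0 f'1 h'0 <- hf']]].
apply: (@homotopic_lift_end R E X p pcov h h' (pmap f) (pmap f')) => //.
  apply: homotopic_push.
  by apply: simply_connected_homotopic => //; rewrite ?f0 ?f1.
by rewrite h0.
Qed.

Lemma deck_graph_proj e e' x x' : deck_graph e e' x x' -> p x' = p x.
Proof. by move=> [f [h [_ <- _ <- hf]]]. Qed.

Lemma deck_graph_total e e' x : p e = p e' -> exists x', deck_graph e e' x x'.
Proof.
move=> ee'; have [f f0 f1] := path_between e x.
have [h h0 hf] : exists2 h : path_space R E, h I0 = e' &
    forall t, p (h t) = pmap f t.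
  by apply: path_lifting => //; rewrite push_pathE f0.
by exists (h I1), f, h.
Qed.

(** Near [x], [g] is [sec \o p] for the sheet through [g x]: a short path leaving [x] is matched by
    the lift of its projection in that sheet. *)
Lemma deck_graph_continuous e e' (g : E -> E) :
  (forall x, deck_graph e e' x (g x)) -> continuous g.
Proof.
move=> gD x.
have [f [h [f0 f1 h0 h1 hf]]] := gD x.
have pg : p (g x) = p x by exact: deck_graph_proj (gD x).
have [U [oU Ut] /(_ _ Ut) [V [sec [sV Vg]]]] := covering_sheet pcov (p (g x)).
have Ux : nbhs x (p @^-1` U).
  by apply: pc; apply: open_nbhs_nbhs; split => //; rewrite -pg.
have [N Nx Npath] := cover_locally_path_connected Ux.
have gE y : N y -> g y = sec (p y).
  move=> /Npath [d [d0 d1 dU]].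
  have kc : continuous (sec \o pmap d).
    by apply: sec_comp_continuous sV _ _ => //; exact: cts_fun.
  have fd : f I1 = d I0 by rewrite f1 d0.
  have hk : h I1 = mkpath kc I0.
    by rewrite mkpathE /= push_pathE d0 -pg (sheet_projK sV Vg).
  apply: (deck_graph_fun (gD y)).
  exists (concat fd), (concat hk); split; rewrite ?concat_0 ?concat_1 //.
    by rewrite mkpathE /= push_pathE d1.
  move=> t; rewrite !concatE /concat_fun; case: ifP => // _.
  by rewrite mkpathE /= push_pathE (sheet_secK sV) //; exact: dU.
have sc : {for x, continuous (sec \o p)}.
  apply: continuous_comp; first exact: pc.
  by apply: (sheet_sec_continuous sV); rewrite -pg.
move=> B; rewrite (gE x (nbhs_singleton Nx)) => /sc.
by apply: filterS2 Nx => y Ny; rewrite /preimage /= gE.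
Qed.

(** Transitivity of the deck group on fibres; exchanging [e] and [e'] gives the inverse. *)
Lemma deck_exists e e' : p e = p e' ->
  exists g : deck p, forall x, deck_graph e e' x (g x).
Proof.
move=> ee'.
have [g gD] := choice (fun x => deck_graph_total x ee').
have [k kD] := choice (fun x => deck_graph_total x (esym ee')).
have gk : cancel g k.
  by move=> x; apply: deck_graph_fun (kD _) _; exact: deck_graph_sym.
have kg : cancel k g.
  by move=> x; apply: deck_graph_fun (gD _) _; exact: deck_graph_sym.
have pg : p \o g = p by apply/funext => x; exact: deck_graph_proj (gD x).
by exists (Deck (deck_graph_continuous gD) (deck_graph_continuous kD) gk kg pg).
Qed.

(** * The map from pairs of points to homotopy classes, and its fibres *)

Lemma deckE (g : deck p) x : p (g x) = p x.
Proof. exact: (congr1 (@^~ x) (deck_over g)). Qed.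

(** The path chosen is immaterial by simple connectedness, as [pair_class_path] records. *)
Definition pair_class (z : E * E) : Pi R X :=
  Pi_proj (pmap (s2val (cid2 (path_between z.1 z.2)))).

Lemma Pi_projP (f g : path_space R X) : Pi_proj f = Pi_proj g <-> homotopic f g.
Proof.
split=> [fg|fg]; first by apply/asboolP; exact/(@eqmodP _ (@homotopic_rel R X)).
by apply/(@eqmodP _ (@homotopic_rel R X))/asboolP.
Qed.

Lemma pair_class_path (f : path_space R E) :
  pair_class (f I0, f I1) = Pi_proj (pmap f).
Proof.
rewrite /pair_class; case: cid2 => h /= h0 h1.
apply/Pi_projP/homotopic_push.
exact: simply_connected_homotopic.
Qed.

Lemma pair_class_lift (g : path_space R X) (f : path_space R E) z :
  Pi_proj g = pair_class z ->
  f I0 = z.1 -> (forall t, p (f t) = g t) -> f I1 = z.2.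
Proof.
case: z => e e'; have [h h0 h1] := path_between e e'.
rewrite -h0 -h1 pair_class_path => /Pi_projP gh f0 fg.
exact: (@homotopic_lift_end R E X p pcov f h g (pmap h)).
Qed.

Lemma pair_class_surj c : exists z, pair_class z = c.
Proof.
elim/quotW: c => f; have [e pe] := cover_surj (f I0).
have [h h0 hf] := path_lifting pcov pe.
exists (h I0, h I1); rewrite pair_class_path; congr Pi_proj.
by apply: path_ext => t; rewrite push_pathE hf.
Qed.

Lemma pair_class_deck (g : deck p) e e' :
  pair_class (g e, g e') = pair_class (e, e').
Proof.
have [f <- <-] := path_between e e'.
rewrite -!(push_pathE (@deck_continuous _ _ _ g)) !pair_class_path.
congr Pi_proj.
by apply: path_ext => t; rewrite !push_pathE deckE.
Qed.

(** Homotopic projections start at the same point, so a deck transformation matches the first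
    points. It then matches the second ones, by lifting the homotopy. *)
Lemma pair_class_eq z w : pair_class z = pair_class w ->
  exists g : deck p, w = (g z.1, g z.2).
Proof.
case: z w => [e e'] [w w'] /=.
have [f f0 f1] := path_between e e'; have [h h0 h1] := path_between w w'.
rewrite -f0 -f1 -h0 -h1 !pair_class_path => /Pi_projP fh.
have [fh0 fh1] := homotopic_ends fh.
have [g gD] := deck_exists fh0.
have gf0 : g (f I0) = h I0.
  apply: deck_graph_fun (gD _) _.
  exists (const_path (f I0)), (const_path (h I0)).
  by split => // t; exact: esym fh0.
exists g; rewrite gf0; congr pair.
apply: (@homotopic_lift_end R E X p pcov h
  (push_path (@deck_continuous _ _ _ g) f) (pmap h) (pmap f)) => //.
    exact: homotopic_sym.
  by move=> t; rewrite !push_pathE deckE.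
Qed.

Lemma Pi_basicE U V (f : path_space R E) c : Pi_basic U V (pmap f) c <->
  exists d1 d2 : path_space R E,
    [/\ d1 I1 = f I0 /\ d2 I0 = f I1, forall t, U (p (d1 t)),
        forall t, V (p (d2 t)) & c = pair_class (d1 I0, d2 I1)].
Proof.
split=> [[d1 [d2 [e1 [e2 [/range_sub d1U /range_sub d2V ->]]]]]|].
  (* Lifting prescribes the start, whereas [d1] is prescribed at its end; so its reverse is lifted,
     then reversed again. *)
  have [r r0 rd] : exists2 r : path_space R E, r I0 = f I0 &
      forall t, p (r t) = reverse_path d1 t.
    by apply: path_lifting => //; rewrite reverse_path0 e1.
  have [k k0 kd] : exists2 k : path_space R E, k I0 = f I1 &
      forall t, p (k t) = d2 t.
    by apply: path_lifting => //; rewrite -e2 concat_1.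
  have e1' : reverse_path r I1 = f I0 by rewrite reverse_path1.
  have e2' : concat e1' I1 = k I0 by rewrite concat_1.
  have rE t : p (reverse_path r t) = d1 t.
    rewrite reverse_pathE rd reverse_pathE; congr (d1 _).
    have t0 := ival_ge0 t; have t1 := ival_le1 t.
    by rewrite clampK; [rewrite -[RHS]ivalK; congr clamp; lra|lra..].
  exists (reverse_path r), k; split => //.
  - by move=> t; rewrite rE.
  - by move=> t; rewrite kd.
  - rewrite -(concat_0 e1') -(concat_0 e2') -(concat_1 e2') pair_class_path.
    congr Pi_proj; apply: path_ext => t.
    rewrite push_pathE !concatE /concat_fun.
    case: ifP => _; last by rewrite kd.
    by rewrite !concatE /concat_fun; case: ifP.
move=> [d1 [d2 [[e1 e2] d1U d2V ->]]].
have e2' : concat e1 I1 = d2 I0 by rewrite concat_1.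
have e1p : pmap d1 I1 = pmap f I0 by rewrite !push_pathE e1.
have e2p : concat e1p I1 = pmap d2 I0 by rewrite concat_1 !push_pathE e2.
exists (pmap d1), (pmap d2), e1p, e2p.
split; [exact/range_sub|exact/range_sub|].
rewrite -(concat_0 e1) -(concat_0 e2') -(concat_1 e2') pair_class_path.
congr Pi_proj; apply: path_ext => t; rewrite push_pathE !concatE /concat_fun.
by case: ifP => // _; rewrite !concatE /concat_fun; case: ifP.
Qed.

Lemma Pi_basis_open (B : set (Pi R X)) : Pi_basis B -> open B.
Proof.
move=> bB; exists [set B]; last by rewrite bigcup_set1.
move=> _ ->; exists [fset B]%fset; last by rewrite set_fset1 bigcap_set1.
move=> C; rewrite inE => /eqP ->; exact: mem_set.
Qed.

Lemma Pi_cvg (F : set_system (Pi R X)) c : Filter F ->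
  (forall B, Pi_basis B -> B c -> F B) -> F --> c.
Proof.
move=> FF bF A; rewrite nbhsE => -[_ [[D sD <-] [C DC Cc]] CA].
apply: filterS CA _; apply: (@filterS _ _ _ C); first by move=> ? ?; exists C.
have [D' sD' IC] := sD _ DC; rewrite -IC; apply: filter_bigI => B BD'.
apply: bF; first exact: set_mem (sD' _ BD').
by move: Cc; rewrite -IC => /(_ _ BD').
Qed.

Lemma pair_class_continuous : continuous pair_class.
Proof.
move=> z; apply: Pi_cvg => _ [U [V [f [nU nV Uf Vf ->]]]] Sz.
have [e pe] := cover_surj (f I0).
have [h h0 hf] := path_lifting pcov pe.
have fE : f = pmap h by apply: path_ext => t; rewrite push_pathE hf.
move: Sz; rewrite fE => /Pi_basicE [d1 [d2 [[e1 e2] d1U d2V Ez]]].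
(* The witnesses [d1], [d2] end up at [z] only up to a deck transformation, so the whole picture is
   translated by [g]. Short paths from [z] over [U] and [V] then extend it to nearby pairs. *)
have [g gz] := pair_class_eq (esym Ez).
pose gm := @push_path R E E g (@deck_continuous _ _ _ g).
have [oU _ _] := nU; have [oV _ _] := nV.
have gz1 : z.1 = gm d1 I0 by rewrite gz.
have gz2 : z.2 = gm d2 I1 by rewrite gz.
have Uz : nbhs z.1 (p @^-1` U).
  by apply: pc; apply: open_nbhs_nbhs; rewrite gz1 push_pathE deckE; split.
have Vz : nbhs z.2 (p @^-1` V).
  by apply: pc; apply: open_nbhs_nbhs; rewrite gz2 push_pathE deckE; split.
have [N Nz Np] := cover_locally_path_connected Uz.
have [M Mz Mp] := cover_locally_path_connected Vz.
have NM : nbhs z (N `*` M) by exists (N, M).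
apply: filterS NM => w [/= /Np [a [a0 a1 aU]] /Mp [b [b0 b1 bV]]].
rewrite /preimage /= (_ : pmap h = pmap (gm h)); last first.
  by apply: path_ext => t; rewrite !push_pathE deckE.
apply/Pi_basicE.
have aj : reverse_path a I1 = gm d1 I0 by rewrite reverse_path1 a0.
have bj : gm d2 I1 = b I0 by rewrite b0.
exists (concat aj), (concat bj); split.
- by rewrite concat_1 concat_0 !push_pathE e1 e2.
- apply: (@concat_sub R E _ _ aj (p @^-1` U)) => t.
    by rewrite reverse_pathE; exact: aU.
  by rewrite /preimage /= push_pathE deckE.
- apply: (@concat_sub R E _ _ bj (p @^-1` V)) => t; last exact: bV.
  by rewrite /preimage /= push_pathE deckE.
- by rewrite concat_0 concat_1 reverse_path0 a1 b1 -surjective_pairing.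
Qed.

(** With [U] and [V] so small that paths over them through the two points stay in [N] and [M], the
    basic set they define lies in the image of the product. *)
Lemma pair_class_open z (W : set (E * E)) :
  nbhs z W -> nbhs (pair_class z) (pair_class @` W).
Proof.
move=> [[N M] /= [Nz Mz] NMW].
have [U [nU Uz UN]] := nice_nbhs Nz; have [V [nV Vz VM]] := nice_nbhs Mz.
have [f f0 f1] := path_between z.1 z.2.
have oS : open (Pi_basic U V (pmap f)).
  apply: Pi_basis_open; exists U, V, (pmap f).
  by rewrite !push_pathE f0 f1; split.
have Sz : Pi_basic U V (pmap f) (pair_class z).
  apply/Pi_basicE; exists (const_path z.1), (const_path z.2).
  by split; rewrite ?f0 ?f1 -?surjective_pairing.
apply: filterS (open_nbhs_nbhs (conj oS Sz)).
move=> c /Pi_basicE [d1 [d2 [[e1 e2] d1U d2V ->]]].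
exists (d1 I0, d2 I1) => //; apply: NMW; split => /=.
  by apply: (UN d1 I1) => //; rewrite e1.
by apply: (VM d2 I0) => //; rewrite e2.
Qed.

End UniversalCover.

(** * The compact-open topology *)

Section CompactOpen.
Context {R : realType}.
Local Notation I := (unit_interval R).

Lemma cvg_path_space (T : Type) (F : set_system T) (X : topologicalType)
    (s : T -> path_space R X) (f : path_space R X) : Filter F ->
  (forall (K : set I) (A : set X), compact K -> open A ->
     (forall t, K t -> A (f t)) ->
     \forall y \near F, forall t, K t -> A (s y t)) ->
  s y @[y --> F] --> f.
Proof.
move=> FF H B [_ [[W oW <-] /= Wf WB]].
apply: filterS WB _.
have : (fun y => s y : {compact-open, I -> X}) @ F -->
    (f : {compact-open, I -> X}).
  apply/compact_open_cvgP => K A cK oA fA.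
  have := H K A cK oA (fun t Kt => fA _ (ex_intro2 _ _ t Kt erefl)).
  by apply: filterS => y sA _ [t Kt <-]; exact: sA.
by apply; exact: open_nbhs_nbhs.
Qed.

Lemma path_space_subbasic (X : topologicalType) (K : set I) (A : set X)
    (f : path_space R X) : compact K -> open A -> (forall t, K t -> A (f t)) ->
  nbhs f [set g : path_space R X | forall t, K t -> A (g t)].
Proof.
move=> cK oA fA.
exists [set g : path_space R X | (g : I -> X) @` K `<=` A]; split => /=.
- by exists [set g | g @` K `<=` A]; first exact: compact_open_open.
- by move=> _ [t Kt <-]; exact: fA.
- by move=> g gA t Kt; apply: gA; exists t.
Qed.

(** By local compactness of the interval, a compact neighbourhood of [t0] gives a subbasic
    neighbourhood of [s y0]. *)
Lemma eval_continuous (Y X : topologicalType) (s : Y -> path_space R X) y0 t0 :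
  {for y0, continuous s} -> {for (y0, t0), continuous (fun z => s z.1 z.2)}.
Proof.
move=> sc B /=; rewrite nbhsE => -[A [oA Ast] AB].
have /compact_near_itv [K [cK Kt KA]] : nbhs t0 (s y0 @^-1` A).
  by apply: (@cts_fun _ _ (s y0) t0); exact: open_nbhs_nbhs.
have := sc _ (path_space_subbasic cK oA KA) => sA.
exists (s @^-1` [set g : path_space R X | forall t, K t -> A (g t)], K) => //.
by move=> [y t] [/= sy Ky]; apply: AB; exact: sy.
Qed.

(** A tube argument: compactness of [K] yields one neighbourhood of [y0] good for all times in
    [K]. *)
Lemma curry_continuous (Y X : topologicalType) (s : Y -> path_space R X) y0 :
  (forall t, {for (y0, t), continuous (fun z => s z.1 z.2)}) ->
  {for y0, continuous s}.
Proof.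
move=> sc; apply: cvg_path_space => K A cK oA sA.
apply: (iffLR (compact_near_coveringP K)) => // t Kt.
have [[M N] /= [My Nt] MN] := sc t _ (open_nbhs_nbhs (conj oA (sA t Kt))).
by exists (N, M) => // -[t' y] [/= Nt' My']; exact: (MN (y, t')).
Qed.

Lemma push_path_space_continuous (X Y : topologicalType) (h : X -> Y)
  (hc : continuous h) : continuous (@push_path R X Y h hc).
Proof.
move=> f; apply: (cvg_path_space (F := nbhs f)) => K A cK oA fA.
apply: (@path_space_subbasic X K (h @^-1` A) f) => //.
by apply: open_comp => // x _; exact: hc.
Qed.

End CompactOpen.

(** * Comparison of the two covers *)

Section Comparison.
Context {R : realType} (E X : topologicalType) (p : E -> X).
Hypothesis lpcX : locally_path_connected R X.
Hypothesis pcov : covering_map p.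
Hypothesis scE : simply_connected R E.
Local Notation I := (unit_interval R).
Local Notation pc := (covering_continuous pcov).
Local Notation pmap := (@push_path R E X p pc).
Local Notation pair_class := (pair_class pcov scE).

Lemma AC_cover_of_TC_cover k :
  TC_cover R (deck_action p) k -> AC_cover R X k.
Proof.
move=> [U [oU invU covU sU]]; exists (fun j => pair_class @` U j); split.
- move=> j; rewrite openE => _ [z Uz <-].
  by apply: pair_class_open => //; exact: open_nbhs_nbhs.
- apply/seteqP; split=> // c _; have [z <-] := pair_class_surj pcov scE c.
  have : [set: E * E] z by [].
  by rewrite -covU => -[j _ Uz]; exists j => //; exists z.
- move=> j; have [s [sc sg se]] := sU j.
  (* Two preimages of [c] in [U j] differ by a deck transformation, and by equivariance so do their
     paths, whose projections thus agree. Off the image of [U j] any representative is a default. *)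
  have /choice [sigma sigmaE] : forall c, exists f : path_space R X,
      forall z, U j z -> pair_class z = c -> f = pmap (s z).
    move=> c.
    have [[z0 Uz0 z0c]|nz] := pselect (exists2 z, U j z & pair_class z = c).
      exists (pmap (s z0)) => z Uz.
      rewrite -z0c => /esym/(pair_class_eq lpcX)[g ->].
      rewrite (sg g z0 Uz0); apply: path_ext => t.
      exact: esym (deckE g (s z0 t)).
    by exists (repr c) => z Uz zc; case: nz; exists z.
  exists sigma; split; last first.
    move=> _ [z Uz <-].
    rewrite (sigmaE _ z Uz erefl) -(pair_class_path pcov scE).
    by have := se z Uz; rewrite /path_ends => ->.
  rewrite continuous_open_subspace; last first.
    rewrite openE => _ [z Uz <-].
    by apply: pair_class_open => //; exact: open_nbhs_nbhs.
  move=> c /set_mem [z Uz <-] B; rewrite (sigmaE _ z Uz erefl) => Bs.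
  have Uzn : nbhs z (U j) by exact: open_nbhs_nbhs.
  have sB : nbhs z (s @^-1` (pmap @^-1` B)).
    move: sc; rewrite continuous_open_subspace // => /(_ z (mem_set Uz)); apply.
    exact: (@push_path_space_continuous R E X p pc (s z) B Bs).
  have UsB : nbhs z (U j `&` s @^-1` (pmap @^-1` B)) by exact: filterI.
  (* Continuity upstairs descends because the quotient map is open. *)
  have := pair_class_open lpcX pcov scE UsB.
  apply: filterS => _ [w [Uw Bw] <-].
  by rewrite /preimage /= (sigmaE _ w Uw erefl).
Qed.

Lemma TC_cover_of_AC_cover k :
  AC_cover R X k -> TC_cover R (deck_action p) k.
Proof.
move=> [V [oV covV sV]]; exists (fun j => pair_class @^-1` V j).
have oPV j : open (pair_class @^-1` V j).
  by apply: open_comp => // z _; exact: pair_class_continuous.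
have invPV (g : deck p) (z : E * E) :
    pair_class (gact_pair (deck_action p) g z) = pair_class z.
  by rewrite /gact_pair /= (pair_class_deck pcov scE) -surjective_pairing.
split => //.
- by move=> j g z; rewrite /preimage /= invPV.
- apply/seteqP; split=> // z _.
  have : [set: Pi R X] (pair_class z) by [].
  by rewrite -covV => -[j _ Vz]; exists j.
move=> j; have [sigma [sigmac sigmaE]] := sV j.
have /choice [s sE] : forall z, exists f : path_space R E, V j (pair_class z) ->
    f I0 = z.1 /\ forall t, p (f t) = sigma (pair_class z) t.
  move=> z; have [Vz|nVz] := pselect (V j (pair_class z)); last first.
    by exists (const_path z.1).
  have pz : p z.1 = sigma (pair_class z) I0.
    (* The chosen path is homotopic, relative to endpoints, to the projection of a path from [z.1];
       hence it starts at [p z.1]. *)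
    have := sigmaE _ Vz; have [f f0 f1] := path_between scE z.1 z.2.
    rewrite [z in _ = pair_class z]surjective_pairing -f0 -f1 pair_class_path.
    by move=> /Pi_projP /homotopic_ends [-> _]; rewrite push_pathE f0.
  by have [f f0 fE] := path_lifting pcov pz; exists f.
exists s; split.
- rewrite continuous_open_subspace // => z0 /set_mem Vz0.
  have Vn : nbhs z0 (pair_class @^-1` V j) by exact: open_nbhs_nbhs.
  have sc : {for z0, continuous (sigma \o pair_class)}.
    apply: continuous_comp; first exact: pair_class_continuous.
    by move: sigmac; rewrite continuous_open_subspace //; apply; exact: mem_set.
  have Vnt (t : I) : nbhs (z0, t) [set w : E * E * I | V j (pair_class w.1)].
    exists (pair_class @^-1` V j, setT) => [|w []//].
    by split => //; exact: filterT.
  apply: curry_continuous.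
  apply: (@lift_jointly_continuous R E X p pcov (E * E)%type z0 s).
  + by move=> z; exact: cts_fun.
  + move=> t B; rewrite /= (proj2 (sE z0 Vz0)) => /(eval_continuous sc).
    apply: filterS2 (Vnt t) => -[z u] /= Vz.
    by rewrite /preimage /= (proj2 (sE z Vz)).
  + move=> B; rewrite /= (proj1 (sE z0 Vz0)) => Bz.
    have : nbhs z0 (fst @^-1` B).
      exact: (@cvg_fst _ _ (nbhs z0.1) (nbhs z0.2)).
    apply: filterS2 Vn => z Vz.
    by rewrite /preimage /= (proj1 (sE z Vz)).
- move=> g z Vz; have [sz0 sz] := sE z Vz.
  have Vgz : V j (pair_class (gact_pair (deck_action p) g z)) by rewrite invPV.
  have [sg0 sg] := sE _ Vgz.
  (* Both sides lift the same path of [X], since the class is invariant, and both start at the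
     translate of [z.1]. *)
  have e : (s (gact_pair (deck_action p) g z) : I -> E) =
      gact_path (deck_action p) g (s z).
    apply: (unique_lift pcov (t0 := I0)).
    + exact: cts_fun.
    + exact: cts_fun.
    + by apply/funext => t; rewrite /= sg invPV -sz; exact: esym (deckE g _).
    + by rewrite sg0 /= -sz0.
  by apply: path_ext => t; exact: (congr1 (@^~ t) e).
- move=> z Vz; have [sz0 sz] := sE z Vz.
  rewrite /path_ends sz0 (pair_class_lift (sigmaE _ Vz) sz0 sz).
  by rewrite -surjective_pairing.
Qed.

End Comparison.

Theorem theorem6p4 (R : realType) (X E : topologicalType) (p : E -> X)
  (goodX : good R X) (pcover : universal_cover R p) :
  asphericity_complexity R X = equivariant_TC R (deck_action p).
Proof.
have [_ lpcX _] := goodX; have [pcov scE] := pcover.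
congr min_nat; apply/funext => k; apply/propext; split.
- exact: TC_cover_of_AC_cover.
- exact: AC_cover_of_TC_cover.
Qed.
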